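(* If a torus $T^k$ acts effectively on a $\mathrm{G}_2$-manifold $(M,\varphi)$ and the action is multi-Hamiltonian, then $2\leqslant k\leqslant4$.
   Context: On $\mathbb R^7$ with dual basis $e^1,\dots,e^7$ put $\varphi_0=e^{123}-e^1(e^{45}+e^{67})-e^2(e^{46}+e^{75})-e^3(e^{47}+e^{56})$ (wedge signs suppressed). A $\mathrm{G}_2$-structure on a connected $7$-manifold $M$ is a $3$-form $\varphi$ pointwise linearly equivalent to $\varphi_0$; it determines a metric $g$ and volume form by $6g(X,Y)\mathrm{vol}=(X\lrcorner\varphi)\wedge(Y\lrcorner\varphi)\wedge\varphi$ and a Hodge dual $4$-form $*\varphi$. $(M,\varphi)$ is a $\mathrm{G}_2$-manifold if $d\varphi=0$ and $d{*\varphi}=0$. Torus actions are assumed to preserve $\varphi$ (hence also $g$ and $*\varphi$). For an Abelian Lie group $G$ acting on a manifold $N$ preserving a closed form $\alpha$ of degree $r$, with $\xi\colon\mathfrak g\to\mathfrak X(N)$ the map to fundamental vector fields (extended to $\Lambda^{r-1}\mathfrak g\to\Gamma(\Lambda^{r-1}TN)$), a multi-moment map is a $G$-invariant map $\nu\colon N\to\Lambda^{r-1}\mathfrak g^*$ with $d\langle\nu,W\rangle=\xi(W)\lrcorner\alpha$ for all $W\in\Lambda^{r-1}\mathfrak g$. The $T^k$-action on $(M,\varphi)$ is called multi-Hamiltonian if there is a multi-moment map for $(\varphi,T^k)$ and/or for $( *\varphi,T^k)$; by convention this includes the requirement that the condition be non-trivial, i.e. $k\geqslant2$ (for $\varphi$),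 respectively $k\geqslant 3$ (for $*\varphi$). *)

(* Defs.v *)
From HB Require Import structures.
From mathcomp Require Import all_boot all_order all_algebra.
From mathcomp Require Import all_fingroup generic_quotient ring_quotient.
From mathcomp Require Import all_classical all_reals all_analysis.

Set Implicit Arguments.
Unset Strict Implicit.
Unset Printing Implicit Defensive.

Import Order.TTheory GRing.Theory Num.Theory numFieldNormedType.Exports.

Local Open Scope quotient_scope.
Local Open Scope classical_set_scope.
Local Open Scope ring_scope.

(** An [r]-form on ['rV[R]_n] is a function of the [r] rows of a matrix; in
    this encoding the pullback of [a] by a linear map of matrix [A] (acting on
    row vectors) is [fun v => a (v *m A)]. *)
Definition alternating_form (R : realType) (r n : nat)
    (a : 'M[R]_(r, n) -> R) : Prop :=
  (forall (A B C : 'M[R]_(r, n)) (i : 'I_r) (b c : R),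
     row i A = b *: row i B + c *: row i C ->
     row' i B = row' i A -> row' i C = row' i A ->
     a A = b * a B + c * a C) /\
  (forall (A : 'M[R]_(r, n)) (i j : 'I_r),
     i != j -> row i A = row j A -> a A = 0).

(** Normalised so that [e^1 /\ ... /\ e^r] is the determinant. *)
Definition wedge (R : realType) (p q n : nat)
    (a : 'M[R]_(p, n) -> R) (b : 'M[R]_(q, n) -> R) (v : 'M[R]_(p + q, n)) : R :=
  (p`! * q`!)%:R^-1 *
  \sum_(s : 'S_(p + q))
    (-1) ^+ s * a (usubmx (row_perm s v)) * b (dsubmx (row_perm s v)).

Definition contract (R : realType) (p q n : nat) (W : 'M[R]_(p, n))
    (a : 'M[R]_(p + q, n) -> R) (v : 'M[R]_(q, n)) : R :=
  a (col_mx W v).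

Definition bilin (R : realType) (n : nat) (g : 'M[R]_n) (X Y : 'rV[R]_n) : R :=
  (X *m g *m Y^T) 0 0.

Definition inner_product (R : realType) (n : nat) (g : 'M[R]_n) : Prop :=
  g^T = g /\ forall X : 'rV[R]_n, X != 0 -> 0 < bilin g X X.

(** The rows of [u] form a [g]-orthonormal basis. *)
Definition orthonormal (R : realType) (n : nat) (g u : 'M[R]_n) : Prop :=
  u *m g *m u^T = 1%:M.

Definition volume_form (R : realType) (n : nat) (g : 'M[R]_n)
    (vol : 'M[R]_n -> R) : Prop :=
  alternating_form vol /\ forall u, orthonormal g u -> `|vol u| = 1.

(** The inner product induced on [p]-forms, in the orthonormal basis [u]; the
    factor [1/p!] compensates for summing over all multi-indices instead of
    the increasing ones. *)
Definition form_inner (R : realType) (p n : nat) (u : 'M[R]_n)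
    (a b : 'M[R]_(p, n) -> R) : R :=
  p`!%:R^-1 *
  \sum_(f : {ffun 'I_p -> 'I_n}) a (rowsub f u) * b (rowsub f u).

(** [b = *a], that is, [c /\ b = <c, a> vol] for all [p]-forms [c]. *)
Definition hodge_dual (R : realType) (p q : nat)
    (g : 'M[R]_(p + q)) (vol : 'M[R]_(p + q) -> R)
    (a : 'M[R]_(p, p + q) -> R) (b : 'M[R]_(q, p + q) -> R) : Prop :=
  alternating_form b /\
  forall (c : 'M[R]_(p, p + q) -> R) (u : 'M[R]_(p + q)),
    alternating_form c -> orthonormal g u ->
    forall v, wedge c b v = form_inner u c a * vol v.

(** [e3 i j k] is [e^{ijk}], with indices numbered from 1 to 7. *)
Definition e3 (R : realType) (i j k : nat) (v : 'M[R]_(3, 7)) : R :=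
  \det (\matrix_(a < 3, b < 3) v a (inord (nth 0%N [:: i; j; k] b).-1)).

Definition phi0 (R : realType) (v : 'M[R]_(3, 7)) : R :=
  e3 1 2 3 v - (e3 1 4 5 v + e3 1 6 7 v)
             - (e3 2 4 6 v + e3 2 7 5 v)
             - (e3 3 4 7 v + e3 3 5 6 v).

Definition g2_form (R : realType) (phi : 'M[R]_(3, 7) -> R) : Prop :=
  exists2 A : 'M[R]_7, A \in unitmx & forall v, phi v = phi0 (v *m A).

(** [6 g(X,Y) vol = (X _| phi) /\ (Y _| phi) /\ phi]. *)
Definition g2_metric_vol (R : realType) (phi : 'M[R]_(3, 7) -> R)
    (g : 'M[R]_7) (vol : 'M[R]_7 -> R) : Prop :=
  [/\ inner_product g, volume_form g vol &
      forall (X Y : 'rV[R]_7) (v : 'M[R]_(2 + 2 + 3, 7)),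
        6%:R * bilin g X Y * vol v =
        wedge (wedge (@contract R 1 2 7 X phi) (@contract R 1 2 7 Y phi)) phi v].

Definition g2_dual (R : realType) (phi : 'M[R]_(3, 7) -> R)
    (psi : 'M[R]_(4, 7) -> R) : Prop :=
  exists (g : 'M[R]_7) (vol : 'M[R]_7 -> R),
    g2_metric_vol phi g vol /\ @hodge_dual R 3 4 g vol phi psi.

(** [f] is of class C^oo on the open set [D]: all its iterated directional
    derivatives exist and are (Frechet) differentiable on [D]. *)
Definition smooth_on (R : realType) (U V : normedModType R) (D : set U)
    (f : U -> V) : Prop :=
  forall (vs : seq U) (x : U), D x ->
    differentiable (foldr (fun v (h : U -> V) => 'D_v h) f vs) x.

(** The two maps are total; only their restrictions to the open sets [dom] and
    [cod], where they are inverse homeomorphisms, are meaningful. *)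
Record chart (R : realType) (n : nat) (M : topologicalType) := Chart {
  dom : set M;
  cod : set 'rV[R]_n;
  coord : M -> 'rV[R]_n;
  point_at : 'rV[R]_n -> M;
  dom_open : open dom;
  cod_open : open cod;
  coord_cod : forall p, dom p -> cod (coord p);
  point_at_dom : forall x, cod x -> dom (point_at x);
  coordK : forall p, dom p -> point_at (coord p) = p;
  point_atK : forall x, cod x -> coord (point_at x) = x;
  coord_continuous : forall p, dom p -> {for p, continuous coord};
  point_at_continuous : forall x, cod x -> {for x, continuous point_at} }.

Record manifold (R : realType) (n : nat) := Manifold {
  points :> topologicalType;
  points_hausdorff : hausdorff_space points;
  points_second_countable : @second_countable points;
  atlas : Type;
  chart_of : atlas -> chart R n points;
  atlas_cover : forall p, exists i, dom (chart_of i) p;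
  atlas_compatible : forall i j,
    smooth_on [set x | cod (chart_of i) x /\
                       dom (chart_of j) (point_at (chart_of i) x)]
      (coord (chart_of j) \o point_at (chart_of i)) }.

Section Manifolds.
Variables (R : realType) (n : nat) (M : manifold R n).
Implicit Types (i j : atlas M) (r k : nat).

(** Coordinate representation of a map [f : M -> M] in the charts [i], [j]. *)
Definition local_rep (f : M -> M) i j : 'rV[R]_n -> 'rV[R]_n :=
  coord (chart_of j) \o f \o point_at (chart_of i).

(** [f^* w = w], for [w] given by its coordinate representations. *)
Definition pullback_invariant r
    (w : atlas M -> 'rV[R]_n -> 'M[R]_(r, n) -> R) (f : M -> M) : Prop :=
  forall i j x, cod (chart_of i) x ->
    dom (chart_of j) (f (point_at (chart_of i) x)) ->
    forall v, w i x v =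
              w j (local_rep f i j x) (v *m jacobian (local_rep f i j) x).

(** A smooth differential form, as its family of coordinate representations.
    Invariance under the identity map is the transformation rule between
    charts. *)
Record diff_form r := DiffForm {
  form_rep :> atlas M -> 'rV[R]_n -> 'M[R]_(r, n) -> R;
  form_alternating : forall i x, cod (chart_of i) x ->
    alternating_form (form_rep i x);
  form_smooth : forall i v,
    smooth_on (cod (chart_of i)) (fun x => form_rep i x v : R);
  form_transition : pullback_invariant form_rep id }.

Definition ext_d r (w : 'rV[R]_n -> 'M[R]_(r, n) -> R)
    (x : 'rV[R]_n) (v : 'M[R]_(r.+1, n)) : R :=
  \sum_(a < r.+1)
    (-1) ^+ a * 'D_(row a v) (fun y => w y (row' a v) : R) x.

Definition closed_form r (w : diff_form r) : Prop :=
  forall i x, cod (chart_of i) x -> forall v, ext_d (w i) x v = 0.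

End Manifolds.

(** [(M, phi)] is a G2-manifold with [psi = *phi]. *)
Record g2_manifold (R : realType) (M : manifold R 7)
    (phi : diff_form M 3) (psi : diff_form M 4) : Prop := G2Manifold {
  g2_connected : connected [set: M];
  g2_pointwise : forall i x, cod (chart_of i) x -> g2_form (phi i x);
  g2_hodge : forall i x, cod (chart_of i) x -> g2_dual (phi i x) (psi i x);
  g2_closed : closed_form phi;
  g2_coclosed : closed_form psi }.

Definition int_lattice (R : realType) (k : nat) : {pred 'rV[R]_k} :=
  fun t => [forall i, t 0 i \is a Num.int].

Fact int_lattice_zmod_closed (R : realType) (k : nat) :
  zmod_closed (@int_lattice R k).
Proof.
split=> [|x y /forallP xZ /forallP yZ]; apply/forallP => i; rewrite !mxE //.
by rewrite rpredB.
Qed.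

HB.instance Definition _ (R : realType) (k : nat) :=
  GRing.isZmodClosed.Build 'rV[R]_k (@int_lattice R k)
    (@int_lattice_zmod_closed R k).

(** [T^k = R^k / Z^k], with Lie algebra [R^k] and exponential map the quotient
    map; the latter being a local diffeomorphism, smoothness of maps out of
    the torus is smoothness of their lifts to [R^k]. *)
Definition torus (R : realType) (k : nat) : zmodType :=
  Quotient.quot (@int_lattice R k).

Definition torus_exp (R : realType) (k : nat) (X : 'rV[R]_k) : torus R k :=
  \pi_(Quotient.quot (@int_lattice R k)) X.

Section Actions.
Variables (R : realType) (n : nat) (M : manifold R n) (k : nat).

Record torus_action := TorusAction {
  act :> torus R k -> M -> M;
  act0 : forall p, act 0 p = p;
  actD : forall s t p, act (s + t) p = act s (act t p);
  act_smooth : forall i j : atlas M,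
    let rep (tx : 'rV[R]_k * 'rV[R]_n) :=
      act (torus_exp tx.1) (point_at (chart_of i) tx.2) in
    let D := [set tx | cod (chart_of i) tx.2 /\ dom (chart_of j) (rep tx)] in
    open D /\ smooth_on D (coord (chart_of j) \o rep) }.

Variable A : torus_action.

Definition effective : Prop := forall t, (forall p, A t p = p) -> t = 0.

Definition preserves r (w : diff_form M r) : Prop :=
  forall t, pullback_invariant w (A t).

Definition fundamental (X : 'rV[R]_k) (i : atlas M) (x : 'rV[R]_n) : 'rV[R]_n :=
  'D_X (fun t : 'rV[R]_k =>
          coord (chart_of i) (A (torus_exp t) (point_at (chart_of i) x))) 0.

(** The rows of [W] are [X_1, ..., X_r]; those of [fundamental_mx W i x] are
    their fundamental vectors at the point of coordinates [x]. *)
Definition fundamental_mx r (W : 'M[R]_(r, k)) (i : atlas M) (x : 'rV[R]_n) :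
    'M[R]_(r, n) :=
  \matrix_a fundamental (row a W) i x.

(** [nu] takes values in the [r]-th exterior power of the dual of the Lie
    algebra, identified with alternating [r]-forms on [R^k]; being linear in
    [W], the defining identity is stated for decomposable
    [W = X_1 /\ ... /\ X_r]. *)
Definition multi_moment_map r (alpha : diff_form M (r + 1))
    (nu : M -> 'M[R]_(r, k) -> R) : Prop :=
  [/\ forall p, alternating_form (nu p),
      forall i W, smooth_on (cod (chart_of i))
                    (fun x => nu (point_at (chart_of i) x) W : R),
      forall t p W, nu (A t p) W = nu p W &
      forall i x, cod (chart_of i) x -> forall W (v : 'rV[R]_n),
        'D_v (fun y => nu (point_at (chart_of i) y) W : R) x =
        contract (fundamental_mx W i x) (alpha i x) v].

End Actions.

Definition multi_hamiltonian (R : realType) (M : manifold R 7) (k : nat)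
    (A : torus_action M k) (phi : diff_form M 3) (psi : diff_form M 4) : Prop :=
  ((2 <= k)%N /\ exists nu, @multi_moment_map R 7 M k A 2 phi nu) \/
  ((3 <= k)%N /\ exists nu, @multi_moment_map R 7 M k A 3 psi nu).

(* Main.v *)
Require Import Defs.
From mathcomp Require Import all_boot all_order all_algebra all_reals.
From mathcomp Require Import all_fingroup generic_quotient ring_quotient.
From mathcomp Require Import all_classical all_analysis.
From mathcomp Require Import ring lra zify.
(* Gives [coord], [dom] and [orthonormal] precedence over their homonyms. *)
Import Defs.

Set Implicit Arguments.
Unset Strict Implicit.
Unset Printing Implicit Defensive.

Import Order.TTheory GRing.Theory Num.Theory numFieldNormedType.Exports.

Local Open Scope quotient_scope.
Local Open Scope ring_scope.

(** Why the theorem holds.  The lower bound is the non-triviality convention.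
    For the upper bound suppose that [k >= 5].

    Multi-moment maps make orbits isotropic: an invariant [nu] is constant
    along orbits, so its derivative in the direction of a fundamental vector
    vanishes, that is, [alpha] vanishes on every tuple of fundamental vectors
    ([multi_moment_isotropic]).

    An effective torus action on a connected manifold is locally free at some
    point ([effective_locally_free_point]).  Otherwise every point [p] is fixed
    by some one-parameter subgroup [exp (s X)] with [X != 0]; by a Dirichlet
    approximation argument the closure of such a subgroup contains an element
    of order two ([half_period_fixed]), which then fixes [p].  The torus has
    only finitely many elements of order two and their fixed point sets are
    closed, so one of these sets contains a nonempty open set
    ([finite_closed_cover]).  But an involution that is the identity on an open
    set is the identity: near a fixed point where its derivative is the
    identity, [F = id + r] with [r] contracting, and [F (F x) = x] gives
    [2 r(x) = r(x) - r(F x)], whence [r = 0] ([involution_germ],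
    [involution_rigidity]).  This contradicts effectiveness.

    Consequently, some tangent space contains a five-dimensional subspace [V]
    on which [phi], respectively [*phi], vanishes.  Neither is possible, and
    both impossibilities come from the nondegeneracy of the cross product:
    [phi(a, b, -) <> 0] for independent [a] and [b] ([g2_nondeg]).  For [phi]
    and [c] in [V], the map [y |-> phi(c, y, -)] sends [V] to the
    two-dimensional annihilator of [V] with a kernel spanned by [c]
    ([g2_form_dim5]).  For [*phi], if [a] and [b] span the orthogonal complement
    of [V], vanishing of [*phi] on [V] forces
    [<a* /\ b* /\ c*, phi> = phi(a, b, c) = 0] for all [c]
    ([g2_dual_dim5]). *)

(** * Nondegeneracy of G2-forms *)

Lemma row3E (R : pzSemiRingType) n (a b c : 'rV[R]_n) (p : 'I_3) m :
  (col_mx (col_mx a b) c : 'M[R]_(3, n)) p m = [:: a 0 m; b 0 m; c 0 m]`_p.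
Proof.
have -> : p = unsplit (fintype.split (p : 'I_(2 + 1))) by rewrite splitK.
case: (fintype.split _) => q /=; last first.
  by rewrite [LHS](col_mxEd (col_mx a b) c) ord1.
have -> : q = unsplit (fintype.split (q : 'I_(1 + 1))) by rewrite splitK.
rewrite [LHS](col_mxEu (col_mx a b) c).
by case: (fintype.split _) => q' /=; rewrite (col_mxEu, col_mxEd) ord1.
Qed.

Lemma e3_col_mx (R : realType) (i j k : nat) (a b c : 'rV[R]_7) :
  let x (u : 'rV[R]_7) m := u 0 (inord m.-1) in
  e3 i j k (col_mx (col_mx a b) c) =
  x a i * (x b j * x c k - x c j * x b k)
  - x a j * (x b i * x c k - x c i * x b k)
  + x a k * (x b i * x c j - x c i * x b j).
Proof.
move=> x; rewrite /e3; set v := (col_mx (col_mx a b) c : 'M[R]_(3, 7)).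
have vE : forall p m, v p m = [:: a 0 m; b 0 m; c 0 m]`_p by exact: row3E.
move: v vE => v vE.
rewrite (expand_det_row _ 0) !big_ord_recl big_ord0 /cofactor.
rewrite !(expand_det_row _ 0) !big_ord_recl !big_ord0 /cofactor !det_mx11.
rewrite !mxE /=.
rewrite !vE /= -!/(x _ _).
rewrite /bump /=; ring.
Qed.

(** Lagrange's identity [|a x b|^2 = |a|^2 |b|^2 - (a . b)^2] for the cross
    product of R^7, whose components are the [phi0(a, b, e_m)]. *)
Lemma phi0_lagrange (R : realType) (a b : 'rV[R]_7) :
  \sum_(m < 7) phi0 (col_mx (col_mx a b) (delta_mx 0 m) : 'M[R]_(3, 7)) ^+ 2 =
  (\sum_m a 0 m ^+ 2) * (\sum_m b 0 m ^+ 2) - (\sum_m a 0 m * b 0 m) ^+ 2.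
Proof.
rewrite !big_ord_recr !big_ord0 /= /phi0 !e3_col_mx /= !mxE /=.
have inord_eq (m : 'I_7) n : (n < 7)%N -> (inord n == m) = (n == m :> nat).
  by move=> n7; rewrite -val_eqE /= inordK.
rewrite !inord_eq //=.
(* The two sides name the indices differently ([inord] against [widen_ord]);
   [ring] needs a single name for each coordinate. *)
have ord_inord (m : 'I_7) : m = inord m by rewrite inord_val.
do ! match goal with |- context [fun_of_matrix a 0 (widen_ord ?h ?x)] =>
  rewrite (ord_inord (widen_ord h x)) /= end.
rewrite (ord_inord ord_max) /=.
ring.
Qed.
Lemma phi0_nondeg (R : realType) (a b : 'rV[R]_7) :
  (forall z : 'rV[R]_7, phi0 (col_mx (col_mx a b) z : 'M[R]_(3, 7)) = 0) ->
  ~~ row_free (col_mx a b).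
Proof.
move=> phiab0; have := phi0_lagrange a b.
rewrite big1 => [|m _]; last by rewrite phiab0 expr0n.
set s := \sum_m a 0 m ^+ 2; set t := \sum_m b 0 m ^+ 2.
set d := \sum_m _ * _ => dE.
(* [|t a - d b|^2 = t (s t - d^2)], which vanishes by Lagrange's identity. *)
have dep : t *: a = d *: b.
  apply/rowP => m; rewrite !mxE; apply/eqP; rewrite -subr_eq0 -sqrf_eq0.
  have : \sum_m (t * a 0 m - d * b 0 m) ^+ 2 = 0.
    have -> p q : \sum_m (p * a 0 m - q * b 0 m) ^+ 2 =
        p * p * s - 2 * p * q * d + q * q * t.
      rewrite /s /d /t !mulr_sumr -sumrB -big_split /=.
      by apply: eq_bigr => i _; ring.
    transitivity (t * (s * t - d ^+ 2)); first by ring.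
    by rewrite -dE mulr0.
  move/eqP; rewrite psumr_eq0 => [/allP /(_ m)|i _]; last exact: sqr_ge0.
  by rewrite mem_index_enum => /(_ isT).
apply/negP => /row_freeP [B]; move=> abB.
pose c : 'rV[R]_(1 + 1) := row_mx t%:M (- d)%:M.
have c0 : c = 0.
  rewrite -[c]mulmx1 -abB mulmxA.
  by rewrite /c mul_row_col !mul_scalar_mx dep scaleNr subrr mul0mx.
have t0 : t = 0.
  by have /rowP/(_ (lshift 1 0)) := c0; rewrite /c row_mxEl !mxE eqxx mulr1n.
have b0 : b = 0.
  apply/rowP => m; rewrite mxE; apply/eqP; rewrite -sqrf_eq0.
  move/eqP: t0; rewrite psumr_eq0 => [/allP /(_ m)|i _]; last exact: sqr_ge0.
  by rewrite mem_index_enum => /(_ isT).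
have : row_mx 0 1%:M *m col_mx a b *m B = row_mx 0 1%:M :> 'rV[R]_(1 + 1).
  by rewrite -mulmxA abB mulmx1.
rewrite mul_row_col mul0mx add0r b0 mulmx0 mul0mx.
move=> /rowP/(_ (rshift 1 0))/eqP.
by rewrite row_mxEr !mxE eqxx eq_sym oner_eq0.
Qed.

(** [phi(a, b, -)] is the metric dual of the cross product of [a] and [b], so
    it vanishes only if [a] and [b] are dependent. *)
Lemma g2_nondeg (R : realType) (phi : 'M[R]_(3, 7) -> R) (a b : 'rV[R]_7) :
  g2_form phi -> (forall z : 'rV[R]_7, phi (col_mx (col_mx a b) z) = 0) ->
  ~~ row_free (col_mx a b).
Proof.
move=> [A Au phiE] phiab0.
rewrite /row_free -(mxrankMfree _ (_ : row_free A)) ?row_free_unit //.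
rewrite mul_col_mx; apply: phi0_nondeg => z.
by rewrite -[z](mulmxKV Au) -!mul_col_mx -phiE phiab0.
Qed.

(** * Alternating forms *)

Section Alternating.
Variables (R : realType) (r n : nat) (a : 'M[R]_(r, n) -> R).
Hypothesis alt_a : alternating_form a.

Lemma alternating_linear (A B C : 'M[R]_(r, n)) (i : 'I_r) (b c : R) :
  (forall j, A i j = b * B i j + c * C i j) ->
  (forall i', i' != i -> B i' =1 A i' /\ C i' =1 A i') ->
  a A = b * a B + c * a C.
Proof.
move=> Ai Ai'; apply: (alt_a.1 A B C i b c).
- by apply/rowP => j; rewrite !mxE Ai.
- apply/matrixP => p j; rewrite !mxE; apply: (Ai' _ _).1.
  by rewrite eq_sym neq_lift.
- apply/matrixP => p j; rewrite !mxE; apply: (Ai' _ _).2.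
  by rewrite eq_sym neq_lift.
Qed.

Lemma alternating_eq0 (A : 'M[R]_(r, n)) (i j : 'I_r) :
  i != j -> A i =1 A j -> a A = 0.
Proof.
by move=> ij e; apply: alt_a.2 ij _; apply/rowP => m; rewrite !mxE e.
Qed.

(** Expand [a] on the matrix whose rows [i] and [j] are both the sum of these
    two rows of [A]. *)
Lemma alternating_tperm (A : 'M[R]_(r, n)) (i j : 'I_r) :
  i != j -> a (row_perm (tperm i j) A) = - a A.
Proof.
move=> ij.
pose M (x y : 'I_n -> R) : 'M[R]_(r, n) :=
  \matrix_(p, q) (if p == i then x q else if p == j then y q else A p q).
have Mi x y q : M x y i q = x q by rewrite mxE eqxx.
have Mj x y q : M x y j q = y q by rewrite mxE eq_sym (negPf ij) eqxx.
have Mo x y x' y' p : p != i -> p != j -> M x y p =1 M x' y' p.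
  by move=> /negPf pi /negPf pj q; rewrite !mxE pi pj.
have Mij x : a (M x x) = 0.
  by apply: (alternating_eq0 ij) => q; rewrite Mi Mj.
pose x := A i; pose y := A j; pose s q := x q + y q.
have addl z : a (M s z) = a (M x z) + a (M y z).
  rewrite (@alternating_linear _ (M x z) (M y z) i 1 1) ?mul1r //.
    by move=> q; rewrite !Mi !mul1r.
  move=> p pi; have [->|pj] := eqVneq p j; last by split; exact: Mo.
  by split=> q; rewrite !Mj.
have addr z : a (M z s) = a (M z x) + a (M z y).
  rewrite (@alternating_linear _ (M z x) (M z y) j 1 1) ?mul1r //.
    by move=> q; rewrite !Mj !mul1r.
  move=> p pj; have [->|pi] := eqVneq p i; last by split; exact: Mo.
  by split=> q; rewrite !Mi.
have := Mij s; rewrite addl !addr !Mij add0r addr0.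
have -> : M x y = A.
  apply/matrixP => p q; rewrite mxE; case: eqP => [->//|_].
  by case: eqP => [->|].
have -> : M y x = row_perm (tperm i j) A.
  apply/matrixP => p q; rewrite !mxE.
  case: tpermP => [->|->|/eqP/negPf-> /eqP/negPf->//].
    by rewrite eqxx.
  by rewrite eq_sym (negPf ij) eqxx.
by move=> /eqP; rewrite addrC addr_eq0 => /eqP.
Qed.

Lemma alternating_row_perm (s : 'S_r) (A : 'M[R]_(r, n)) :
  a (row_perm s A) = (-1) ^+ s * a A.
Proof.
have [ts -> neqs] := prod_tpermP s.
elim: ts neqs A => [_ A|t ts IH /= /andP[tneq tsneq] A].
  by rewrite big_nil row_perm1 odd_perm1 mul1r.
rewrite big_cons row_permM alternating_tperm // IH // odd_mul_tperm tneq.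
by rewrite signrN mulNr.
Qed.
End Alternating.

Lemma row_linearE (R : pzRingType) n (f : 'rV[R]_n -> R) :
  (forall p q u v, f (p *: u + q *: v) = p * f u + q * f v) ->
  forall y, f y = \sum_i y 0 i * f (delta_mx 0 i).
Proof.
move=> flin y; rewrite {1}[y]row_sum_delta.
have f0 : f 0 = 0 by have := flin 0 0 0 0; rewrite !scale0r addr0 !mul0r addr0.
have fD u v : f (u + v) = f u + f v.
  by have := flin 1 1 u v; rewrite !scale1r !mul1r.
rewrite (big_morph f fD f0); apply: eq_bigr => i _.
by have := flin (y 0 i) 0 (delta_mx 0 i) 0; rewrite scale0r addr0 mul0r addr0.
Qed.

Section ThreeForm.
Variables (R : realType) (n : nat) (phi : 'M[R]_(3, n) -> R).
Hypothesis phi_alt : alternating_form phi.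

Lemma three_form_linear2 (a c : 'rV[R]_n) p q (u v : 'rV[R]_n) :
  phi (col_mx (col_mx a (p *: u + q *: v : 'rV_n)) c) =
  p * phi (col_mx (col_mx a u) c) + q * phi (col_mx (col_mx a v) c).
Proof.
apply: (@alternating_linear _ _ _ _ phi_alt _ _ _ 1) => [j|i i1].
  by rewrite !row3E /= !mxE.
split=> j; rewrite !row3E; by case: i i1 => [[|[|[|]]]].
Qed.

Lemma three_form_linear3 (a b : 'rV[R]_n) p q (u v : 'rV[R]_n) :
  phi (col_mx (col_mx a b) (p *: u + q *: v : 'rV_n)) =
  p * phi (col_mx (col_mx a b) u) + q * phi (col_mx (col_mx a b) v).
Proof.
apply: (@alternating_linear _ _ _ _ phi_alt _ _ _ (inord 2)) => [j|i i1].
  by rewrite !row3E /= !inordK //= !mxE.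
have {i1} : i != 2%N :> nat.
  by apply: contra i1 => /eqP i2; apply/eqP/val_inj; rewrite /= inordK.
by case: i => [[|[|[|]]]] // ? _; split=> j; rewrite !row3E.
Qed.

End ThreeForm.

Lemma row_free_col_mx (F : fieldType) n (e y : 'rV[F]_n) :
  e != 0 -> ~~ (y <= e)%MS -> row_free (col_mx e y).
Proof.
move=> e0 yNe; rewrite /row_free eqn_leq rank_leq_row /= ltnNge.
apply: contra yNe => rk1.
have e1 : \rank e = 1%N by rewrite rank_rV e0.
have le : (e <= col_mx e y)%MS by rewrite -addsmxE addsmxSl.
have := mxrank_leqif_sup le; rewrite e1 => -[h1 h2].
have : (col_mx e y <= e)%MS.
  by rewrite -h2 eqn_leq h1.
by apply: submx_trans; rewrite -addsmxE addsmxSr.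
Qed.

(** Fix [c] in [V].  If [phi] vanished on [V], the map [y |-> phi(c, y, -)]
    from [V] to the annihilator of [V] would have rank at most [7 - 5 = 2],
    hence a kernel of dimension at least 3, whereas nondegeneracy only allows
    the line spanned by [c]. *)
Lemma g2_form_dim5 (R : realType) (phi : 'M[R]_(3, 7) -> R) (V : 'M[R]_(5, 7)) :
  alternating_form phi -> g2_form phi -> row_free V ->
  ~ (forall B : 'M[R]_(3, 5), phi (B *m V) = 0).
Proof.
move=> alt g2 Vfree phi0.
(* [L] is the matrix of [y |-> phi(c, y, -)] in the basis [V] of its domain. *)
pose e : 'rV[R]_5 := delta_mx 0 0; pose c := e *m V.
pose F (y : 'rV[R]_5) (z : 'rV[R]_7) := phi (col_mx (col_mx c (y *m V)) z).
pose L := \matrix_(i < 5, m < 7) F (delta_mx 0 i) (delta_mx 0 m).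
have FL y z : F y z = (y *m L *m z^T) 0 0.
  rewrite mxE (row_linearE (f := F y)); last exact: three_form_linear3.
  apply: eq_bigr => m _; rewrite !mxE mulrC; congr (_ * _).
  rewrite (row_linearE (f := F^~ (delta_mx 0 m))) => [|p q u v].
    by apply: eq_bigr => i _; rewrite mxE.
  by rewrite /F mulmxDl -!scalemxAl three_form_linear2.
have LV0 : L *m V^T = 0.
  apply/matrixP => i j; rewrite [RHS]mxE.
  pose d l : 'rV[R]_5 := delta_mx 0 l.
  transitivity ((d i *m L *m (d j *m V)^T) 0 0).
    rewrite trmx_mul trmx_delta mulmxA -(mulmxA _ L) -rowE -colE.
    by rewrite [RHS]mxE [RHS]mxE.
  by rewrite -FL /F /c -!mul_col_mx phi0.
have rkL : (\rank (kermx L) > 1)%N.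
  have := mulmx0_rank_max LV0; rewrite mxrank_ker mxrank_tr (eqP Vfree); lia.
have [i yNe] : exists i, ~~ (row i (kermx L) <= e)%MS.
  apply/row_subPn; apply: contraL rkL => /mxrankS.
  by rewrite -leqNgt => h; apply: leq_trans h (rank_leq_row _).
set y := row i _ in yNe.
have yL : y *m L = 0 by apply/sub_kermxP; exact: row_sub.
have e0 : e != 0.
  by apply/eqP => /rowP/(_ 0)/eqP; rewrite !mxE oner_eq0.
have : ~~ row_free (col_mx c (y *m V)).
  by apply: g2_nondeg g2 _ => z; rewrite -[LHS]/(F y z) FL yL mul0mx mxE.
by rewrite -mul_col_mx /row_free mxrankMfree // -/(row_free _) row_free_col_mx.
Qed.

(** * Orthonormal bases *)

Section GramSchmidt.
Variables (R : realType) (n : nat) (g : 'M[R]_n).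
Hypothesis g_inner : inner_product g.

Lemma gram_schmidt m (W : 'M[R]_(m, n)) : row_free W ->
  exists2 U : 'M[R]_(m, n), U *m g *m U^T = 1%:M & (U <= W)%MS.
Proof.
elim: m W => [W _|m IHm].
  by exists 0; rewrite ?sub0mx //; apply/matrixP => -[].
rewrite -[m.+1]/(1 + m)%N => W Wfree.
pose w : 'rV_n := usubmx W.
pose W' : 'M[R]_(m, n) := dsubmx W.
have WE : W = col_mx w W' by rewrite vsubmxK.
have wW : (w <= W)%MS by rewrite WE -addsmxE addsmxSl.
have W'W : (W' <= W)%MS by rewrite WE -addsmxE addsmxSr.
have W'free : row_free W'.
  have := mxrank_adds_leqif w W'.
  rewrite addsmxE -WE (eqP Wfree) => -[h _].
  rewrite /row_free eqn_leq rank_leq_row /=.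
  by have := rank_leq_row w; lia.
have [U' U'1 U'W'] := IHm _ W'free.
pose p := w - w *m g *m U'^T *m U'.
have p0 : p != 0.
  apply/eqP => /eqP; rewrite subr_eq0 => /eqP wE.
  have /mxrankS : (W <= W')%MS.
    rewrite WE -addsmxE addsmx_sub submx_refl andbT wE.
    exact: submx_trans (submxMl _ _) U'W'.
  by rewrite (eqP Wfree) (eqP W'free) ltnn.
have pU' : p *m g *m U'^T = 0.
  by rewrite /p !mulmxBl -!(mulmxA (w *m g *m U'^T)) U'1 mulmx1 subrr.
have l0 : 0 < bilin g p p by exact: g_inner.2.
pose q := (Num.sqrt (bilin g p p))^-1 *: p.
exists (col_mx q U').
  have qU' : q *m g *m U'^T = 0 by rewrite /q -!scalemxAl pU' scaler0.
  rewrite tr_col_mx mul_col_mx mul_col_row U'1 qU'.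
  have -> : U' *m g *m q^T = 0.
    by apply: trmx_inj; rewrite trmx0 !trmx_mul trmxK g_inner.1 mulmxA.
  rewrite (scalar_mx_block 1 m); congr (block_mx _ _ _ _).
  rewrite /q linearZ /= -!scalemxAl -scalemxAr [p *m g *m _]mx11_scalar.
  rewrite -/(bilin g p p) !scale_scalar_mx mulrA -invfM -expr2.
  rewrite sqr_sqrtr ?ltW //.
  by rewrite mulVf ?gt_eqF.
rewrite -addsmxE addsmx_sub (submx_trans U'W' W'W) andbT.
rewrite scalemx_sub // /p addmx_sub // eqmx_opp.
exact: submx_trans (submxMl _ _) (submx_trans U'W' W'W).
Qed.

Lemma orthonormal_rows p q (K : 'M[R]_(p, n)) : \rank K = q ->
  exists2 U : 'M[R]_(q, n), U *m g *m U^T = 1%:M & (U <= K)%MS.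
Proof.
move=> <-; have [U U1 UK] := gram_schmidt (row_base_free K).
by exists U => //; rewrite -(eq_row_base K).
Qed.

End GramSchmidt.

Lemma orthonormal_extension (R : realType) m q (g : 'M[R]_(m + q))
    (W : 'M[R]_(m, m + q)) :
  inner_product g -> row_free W ->
  exists (U : 'M[R]_(m, m + q)) (U' : 'M[R]_(q, m + q)),
    orthonormal g (col_mx U U') /\ (U <= W)%MS.
Proof.
move=> g_inner Wfree; have [U U1 UW] := gram_schmidt g_inner Wfree.
have rkU : \rank (g *m U^T) = m.
  apply/eqP; rewrite eqn_leq rank_leq_col /=.
  by have := mxrankM_maxr U (g *m U^T); rewrite mulmxA U1 mxrank1.
have [|U' U'1 U'K] := @orthonormal_rows _ _ _ g_inner _ q (kermx (g *m U^T)).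
  by rewrite mxrank_ker rkU addKn.
have U'U : U' *m g *m U^T = 0 by rewrite -mulmxA; apply/sub_kermxP.
have UU' : U *m g *m U'^T = 0.
  by apply: trmx_inj; rewrite trmx0 !trmx_mul trmxK g_inner.1 mulmxA.
exists U, U'; split=> //.
by rewrite /orthonormal tr_col_mx mul_col_mx mul_col_row U1 U'1 UU' U'U
  (scalar_mx_block m q).
Qed.


(** * The Hodge dual of a G2-form *)

Section DeterminantForm.
Variables (R : realType) (n : nat).

Lemma det_form_alternating r (K : 'M[R]_(n, r)) :
  alternating_form (fun M : 'M[R]_(r, n) => \det (M *m K)).
Proof.
split=> [A B C i b c Ai BA CA|A i j ij Aij].
  apply: (determinant_multilinear (i0 := i)).
  - by rewrite !row_mul Ai mulmxDl !scalemxAl.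
  - apply/matrixP => p q; rewrite !mxE; apply: eq_bigr => k _.
    by have /matrixP/(_ p k) := BA; rewrite !mxE => ->.
  - apply/matrixP => p q; rewrite !mxE; apply: eq_bigr => k _.
    by have /matrixP/(_ p k) := CA; rewrite !mxE => ->.
apply: (determinant_alternate ij) => k.
have /rowP/(_ k) : row i (A *m K) = row j (A *m K) by rewrite !row_mul Aij.
by rewrite !mxE.
Qed.

Variables (g u : 'M[R]_n).
Hypothesis u1 : orthonormal g u.

(** The form [u_(h 0)* /\ ... /\ u_(h (r - 1))*], where [u_i*] is the covector
    [g(-, u_i)] dual to the row [u_i] of the orthonormal basis [u]. *)
Definition coframe_wedge r (h : 'I_r -> 'I_n) (M : 'M[R]_(r, n)) : R :=
  \det (M *m (g *m (rowsub h u)^T)).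

Lemma coframe_wedge_rowsub r (f h : 'I_r -> 'I_n) :
  coframe_wedge h (rowsub f u) =
  \sum_(s : 'S_r) (-1) ^+ s * [forall p, f p == h (s p)]%:R.
Proof.
rewrite /coframe_wedge /determinant; apply: eq_bigr => s _; congr (_ * _).
have E i j : (rowsub f u *m (g *m (rowsub h u)^T)) i j = (f i == h j)%:R.
  have -> : rowsub f u *m (g *m (rowsub h u)^T) = mxsub f h (u *m g *m u^T).
    rewrite -mulmxA; apply/matrixP => p q; rewrite !mxE.
    apply: eq_bigr => k _; rewrite !mxE; congr (_ * _).
    by apply: eq_bigr => l _; rewrite !mxE.
  by rewrite [_ *m _]u1 !mxE.
case: forallP => [fhs|/forallP]; first by rewrite big1 // => p _; rewrite E fhs.
rewrite negb_forall => /existsP[p /negPf fhsp].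
by rewrite (bigD1 p) //= E fhsp mul0r.
Qed.

(** Only the [r!] multi-indices that are permutations of [h] contribute, and
    they contribute equally, since the signs of both forms cancel. *)
Lemma form_inner_coframe_wedge r (h : 'I_r -> 'I_n) (a : 'M[R]_(r, n) -> R) :
  alternating_form a -> form_inner u (coframe_wedge h) a = a (rowsub h u).
Proof.
move=> alt; rewrite /form_inner.
under eq_bigr do rewrite coframe_wedge_rowsub mulr_suml.
rewrite exchange_big /=.
under eq_bigr => s _.
  rewrite (bigD1 [ffun p => h (s p)]) //= big1 => [|f /eqP fNhs]; last first.
    case: forallP => [fhs|_]; last by rewrite mulr0 mul0r.
    by case: fNhs; apply/ffunP => p; rewrite ffunE (eqP (fhs p)).
  have -> : [forall p, [ffun p => h (s p)] p == h (s p)].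
    by apply/forallP => p; rewrite ffunE.
  have -> : rowsub [ffun p => h (s p)] u = row_perm s (rowsub h u).
    by apply/matrixP => p q; rewrite !mxE ffunE.
  rewrite alternating_row_perm // addr0 mulr1 mulrA -signr_addb addbb mul1r.
  over.
rewrite sumr_const card_Sn -[X in _ * X]mulr_natl mulrA mulVf ?mul1r //.
Qed.

End DeterminantForm.

(** Test the defining identity [c /\ psi = <c, phi> vol] of [psi = *phi] on an
    orthonormal basis [u] whose first five rows span [V], with
    [c = u_6* /\ u_7* /\ u_b*].  In [c /\ psi] every term vanishes: either the
    four arguments of [psi] lie in [V], or one of [u_6] and [u_7] is missing
    from the arguments of [c].  The right-hand side is
    [phi(u_6, u_7, u_b) vol(u)], which is nonzero for some [b] by
    nondegeneracy. *)
Lemma g2_dual_dim5 (R : realType) (phi : 'M[R]_(3, 7) -> R)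
    (psi : 'M[R]_(4, 7) -> R) (V : 'M[R]_(5, 7)) :
  alternating_form phi -> g2_form phi -> g2_dual phi psi -> row_free V ->
  ~ (forall B : 'M[R]_(4, 5), psi (B *m V) = 0).
Proof.
move=> alt g2 [g [vol [[g_inner [vol_alt vol1] _] [psi_alt hodge]]]] Vfree psi0.
have [U [U' [u1 /submxP[B UB]]]] :=
  @orthonormal_extension R 5 2 g V g_inner Vfree.
set u : 'M[R]_7 := col_mx U U' in u1.
have uE (i : 'I_7) m : (i < 5)%N -> u i m = U (inord i) m.
  move=> i5; have -> : i = lshift 2 (inord i : 'I_5).
    by apply: val_inj; rewrite /= inordK.
  by rewrite [LHS]col_mxEu; congr (U _ _); apply: val_inj; rewrite /= !inordK.
clearbody u.
have [u_unit _] := mulmx1_unit (etrans (mulmxA u g u^T) u1).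
(* [u_6] and [u_7], counting from 1. *)
pose i6 : 'I_7 := inord 5; pose i7 : 'I_7 := inord 6.
have i67 : (i6 == i7) = false by rewrite -val_eqE /= !inordK.
pose h b (i : 'I_3) : 'I_7 := nth b [:: i6; i7; b] i.
have [b phib] : exists b, phi (rowsub (h b) u) != 0.
  apply/existsP; apply: contraT; rewrite negb_exists => /forallP phi0.
  have ufree : row_free (col_mx (row i6 u) (row i7 u)).
    rewrite -[u]mul1mx !row_mul -mul_col_mx /row_free mxrankMfree; last first.
      by rewrite row_free_unit.
    apply: row_free_col_mx.
      by apply/eqP => /rowP/(_ i6)/eqP; rewrite !mxE eqxx oner_eq0.
    apply/sub_rVP => -[a /rowP/(_ i7)/eqP]; rewrite !mxE eqxx i67 mulr0.
    by rewrite oner_eq0.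
  rewrite -(negPf (g2_nondeg (a := row i6 u) (b := row i7 u) g2 _)) // => z.
  rewrite -(mulmxKV u_unit z).
  pose F (y : 'rV[R]_7) :=
    phi (col_mx (col_mx (row i6 u) (row i7 u)) (y *m u : 'rV_7)).
  rewrite -[LHS]/(F _) row_linearE => [|p q v w].
    apply: big1 => i _; rewrite /F -rowE.
    have -> : col_mx (col_mx (row i6 u) (row i7 u)) (row i u) =
              rowsub (h i) u :> 'M[R]_(3, 7).
      by apply/matrixP => k m; rewrite row3E !mxE /h; case: k => [[|[|[|]]]].
    by have /negPn/eqP-> := phi0 i; rewrite mulr0.
  by rewrite /F mulmxDl -!scalemxAl three_form_linear3.
have := hodge (coframe_wedge g u (h b)) u (det_form_alternating _) u1 u.
rewrite form_inner_coframe_wedge //.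
have -> : wedge (coframe_wedge g u (h b)) psi u = 0.
  rewrite /wedge big1 ?mulr0 // => s _.
  have [s5|] := boolP [forall k : 'I_4, s (rshift 3 k) < 5]%N.
    have -> : dsubmx (row_perm s u) =
              rowsub (fun k : 'I_4 => inord (s (rshift 3 k)) : 'I_5) U.
      by apply/matrixP => k m; rewrite !mxE uE // (forallP s5).
    by rewrite UB -mul_rowsub_mx psi0 mulr0.
  rewrite negb_forall => /existsP[k sk].
  have -> : usubmx (row_perm s u) = rowsub (fun i => s (lshift 4 i)) u.
    by apply/matrixP => i m; rewrite !mxE.
  rewrite coframe_wedge_rowsub // big1 ?mulr0 ?mul0r // => t _.
  case: forallP => [st|_]; last by rewrite mulr0.
  (* [c] being nonzero, both [u_6] and [u_7] occur among its arguments, which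
     leaves none of them for the index [k] of an argument of [psi]. *)
  have lt7 i : (s i < 7)%N by [].
  have sinj i : s (lshift 4 i) != s (rshift 3 k) :> nat.
    by rewrite val_eqE (inj_eq perm_inj) eq_lrshift.
  have := sinj (t^-1%g 0); have := sinj (t^-1%g 1).
  have := st (t^-1%g 0); have := st (t^-1%g 1); rewrite !permKV /h /=.
  move=> /eqP-> /eqP->; rewrite /i6 /i7 !inordK //.
  have := lt7 (rshift 3 k); move: sk.
  by case: (nat_of_ord _) => [|[|[|[|[|[|[|]]]]]]].
by move/esym/eqP; rewrite mulf_eq0 (negPf phib) /= -normr_eq0 vol1 ?oner_eq0.
Qed.

(** * Approximation of elements of order two *)

Section Dirichlet.
Variables (R : realType) (k : nat).

(** Dirichlet's simultaneous approximation theorem: two of the first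
    [(N + 1)^k + 1] multiples of [x] have fractional parts in the same cell of
    the subdivision of the unit cube into [(N + 1)^k] cubes. *)
Lemma simultaneous_approximation (x : 'I_k -> R) (e : R) : 0 < e ->
  exists (T : nat) (m : 'I_k -> int), (0 < T)%N /\
    forall i, `|T%:R * x i - (m i)%:~R| < e.
Proof.
move=> e0; pose N := Num.bound e^-1.
have Ne : (N.+1)%:R^-1 < e.
  rewrite invf_plt ?posrE ?ltr0n //.
  by apply: lt_trans (archi_boundP _) _; rewrite ?invr_ge0 ?ltW // ltr_nat.
pose fl (a : nat) i : int := Num.floor (a%:R * x i).
pose fr (a : nat) i : R := a%:R * x i - (fl a i)%:~R.
have fr0 a i : 0 <= fr a i.
  by rewrite subr_ge0; have /andP[] := floor_itv (a%:R * x i).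
have fr1 a i : fr a i < 1.
  rewrite ltrBlDl; have /andP[_] := floor_itv (a%:R * x i).
  by rewrite intrD addrC.
pose cell (a : 'I_(N.+1 ^ k).+1) : {ffun 'I_k -> 'I_N.+1} :=
  [ffun i => inord (Num.trunc (N.+1%:R * fr a i))].
have : ~~ injectiveb cell.
  apply/negP => /injectiveP/leq_card; rewrite card_ffun !card_ord.
  by rewrite ltnn.
case/injectivePn => a [b ab cab].
wlog lt_ab : a b ab cab / (a < b)%N.
  move=> W; have [|ba|ab'] := ltngtP a b; first exact: W.
    by apply: (W b a); rewrite // eq_sym.
  by case/eqP: ab; exact/val_inj.
exists (b - a)%N, (fun i => fl b i - fl a i); split; first by rewrite subn_gt0.
move=> i.
have -> : (b - a)%:R * x i - (fl b i - fl a i)%:~R = fr b i - fr a i.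
  by rewrite natrB 1?ltnW // intrB /fr; ring.
apply: lt_trans Ne.
have := congr1 (fun c : {ffun 'I_k -> 'I_N.+1} => val (c i)) cab.
rewrite !ffunE /=.
have trN c : (Num.trunc (N.+1%:R * fr c i) < N.+1)%N.
  have /andP[h _] := truncn_itv (mulr_ge0 (ler0n R N.+1) (fr0 c i)).
  rewrite -(ltr_nat R) (le_lt_trans h) // gtr_pMr ?ltr0n //.
rewrite !inordK // => tE.
have /andP[a1 a2] := truncn_itv (mulr_ge0 (ler0n R N.+1) (fr0 a i)).
have /andP[b1 b2] := truncn_itv (mulr_ge0 (ler0n R N.+1) (fr0 b i)).
rewrite tE in a1 a2.
rewrite -(ltr_pM2l (ltr0n R N.+1)) divff ?pnatr_eq0 //.
rewrite -{1}[N.+1%:R]ger0_norm ?ler0n // -normrM mulrBr ltr_norml.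
move: a1 a2 b1 b2; rewrite -[(Num.trunc _).+1%:R]natr1; lra.
Qed.

(** For nonempty [S], these are representatives of the elements of order two
    of the torus. *)
Definition half_indicator (S : {set 'I_k}) : 'rV[R]_k :=
  \row_i (if i \in S then 2^-1 else 0).

(** If all the [m i] are even, halving both [T] and [m] improves the
    approximation; this terminates since [m i0 != 0].  Once some [m i] is odd,
    half of [m] is an integral translate of a nonzero half indicator. *)
Lemma odd_approximation (x : 'rV[R]_k) (e : R) (N : nat) (T : R)
    (m : 'I_k -> int) i0 :
  (`|m i0| <= N)%N -> m i0 != 0 ->
  (forall i, `|T * x 0 i - (m i)%:~R| < e) ->
  exists (s : R) (S : {set 'I_k}) (q : 'I_k -> int), S != finset.set0 /\
    forall i, `|s * x 0 i - half_indicator S 0 i - (q i)%:~R| < e.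
Proof.
elim: N T m => [|N IHN] T m.
  by rewrite leqn0 absz_eq0 => /eqP->; rewrite eqxx.
move=> mN m0 Tm.
pose S := [set i | odd `|m i|%N].
pose q i := ((m i - (odd `|m i|%N)%:Z) %/ 2)%Z.
have mE i : m i = q i * 2 + (odd `|m i|%N)%:Z.
  by rewrite /q; lia.
have Tm2 i : `|T / 2 * x 0 i - (m i)%:~R / 2| < e.
  have -> : T / 2 * x 0 i - (m i)%:~R / 2 = (T * x 0 i - (m i)%:~R) / 2 by ring.
  have half : `|2^-1| = 2^-1 :> R by rewrite ger0_norm ?invr_ge0.
  rewrite normrM half ltr_pdivrMr ?ltr0n //.
  by have := Tm i; have := normr_ge0 (T * x 0 i - (m i)%:~R); lra.
have [S0|S0] := eqVneq S finset.set0.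
  have mev i : odd `|m i|%N = false.
    by have := finset.in_set0 i; rewrite -S0 inE.
  have mq i : m i = q i * 2 by rewrite {1}mE mev addr0.
  apply: (IHN (T / 2) q) => [||i].
  - by have := mq i0; move: mN m0; lia.
  - by apply: contra m0 => /eqP q0; rewrite mq q0 mul0r.
  - by have := Tm2 i; rewrite {1}mq intrM mulfK // intr_eq0.
exists (T / 2), S, q; split=> // i.
have := Tm2 i; rewrite {1}mE intrD intrM mulrDl mulfK ?intr_eq0 // mxE inE.
rewrite opprD addrA addrAC.
by case: (odd _); rewrite /= ?mul1r ?mul0r.
Qed.

(** The closure of a one-parameter subgroup of the torus contains an element of
    order two. *)
Lemma half_indicator_approximation (x : 'rV[R]_k) (e : R) : x != 0 -> 0 < e ->
  exists (s : R) (S : {set 'I_k}) (q : 'I_k -> int), S != finset.set0 /\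
    forall i, `|s * x 0 i - half_indicator S 0 i - (q i)%:~R| < e.
Proof.
move=> x0 e0.
have [i0 xi0] : exists i, x 0 i != 0 by apply/rV0Pn.
have e'0 : 0 < Num.min e 1 by rewrite lt_min e0 ltr01.
(* With the coordinate [i0] normalised to 1, an approximation of error less
   than 1 of a positive multiple cannot be zero. *)
have [T [m [T0 Tm]]] :=
  simultaneous_approximation (fun i => x 0 i / x 0 i0) e'0.
apply: (@odd_approximation x e `|m i0|%N (T%:R / x 0 i0) m i0) => // [|i].
  apply/eqP => m0; have := Tm i0; rewrite m0 subr0 divff // mulr1 lt_min.
  rewrite ger0_norm ?ler0n // => /andP[_]; apply/negP; rewrite -leNgt.
  by rewrite ler1n.
have := Tm i; rewrite lt_min => /andP[h _].
by rewrite mulrAC -mulrA.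
Qed.

End Dirichlet.

Local Open Scope classical_set_scope.

(** * Involutions tangent to the identity *)

Section MeanValue.
Variables (R : realType) (V : normedModType R).

Lemma mean_value_segment (f : V -> R) (x v : V) :
  (forall s : R, 0 <= s <= 1 -> differentiable f (x + s *: v)) ->
  exists2 s : R, 0 <= s <= 1 & f (x + v) - f x = 'D_v f (x + s *: v).
Proof.
move=> df; pose g s := f (x + s *: v).
have growth s : (fun h => h^-1 *: ((g \o shift s) (h *: 1) - g s)) =
    (fun h => h^-1 *: ((f \o shift (x + s *: v)) (h *: v) - f (x + s *: v))).
  apply/funext => h; rewrite /g /= scalerDl addrCA.
  by rewrite [h *: 1]mulr1.
have gD (s : R) : 0 <= s <= 1 -> is_derive s 1 g ('D_v f (x + s *: v)).
  move=> /df /(@diff_derivable _ _ _ _ _ v) fv; split.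
    by rewrite /derivable growth.
  by rewrite /derive growth.
have [||s s01 gE] := @MVT_segment R g (fun s => 'D_v f (x + s *: v)) 0 1 ler01.
- by move=> s; rewrite in_itv /= => /andP[s0 s1]; apply: gD; rewrite !ltW.
- apply: derivable_within_continuous => s; rewrite in_itv /= => /gD gs.
  exact: ex_derive.
exists s; first by move: s01; rewrite in_itv.
by move: gE; rewrite /g subr0 mulr1 scale1r scale0r addr0.
Qed.

End MeanValue.

Section Coordinates.
Variable R : realType.

Lemma mx_entry_le_norm m n (x : 'M[R]_(m, n)) i j : `|x i j| <= `|x|.
Proof.
rewrite [leRHS]mx_normrE.
exact: (le_bigmax_cond _ (fun ij => `|x ij.1 ij.2|) (j := (i, j))).
Qed.

Lemma mx_norm_le m n (x : 'M[R]_(m, n)) (e : R) :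
  0 <= e -> (forall i j, `|x i j| <= e) -> `|x| <= e.
Proof. by move=> e0 xe; rewrite [leLHS]mx_normrE; apply: bigmax_le. Qed.

Variables (V : normedModType R) (m n : nat).

Lemma differentiable_entry (F : V -> 'M[R]_(m, n)) x i j :
  differentiable F x -> differentiable (fun y => F y i j) x.
Proof.
by move=> dF; exact: differentiable_comp dF (differentiable_coord _ _ _).
Qed.

Lemma derive_entry (F : V -> 'M[R]_(m, n)) x v i j :
  differentiable F x -> 'D_v (fun y => F y i j) x = ('D_v F x) i j.
Proof. by move=> dF; rewrite (derive_mx (diff_derivable (v := v) dF)) mxE. Qed.

End Coordinates.

Section TangentToIdentity.
Variables (R : realType) (n : nat) (F : 'rV[R]_n -> 'rV[R]_n) (x0 : 'rV[R]_n).
Hypothesis F_diff : \forall x \near x0, differentiable F x.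
Hypothesis F_C1 : forall v, {for x0, continuous (fun x => 'D_v F x)}.
Hypothesis F_tangent : forall v, 'D_v F x0 = v.

(** The derivative of [F - id] is small near [x0], and the mean value theorem
    along segments bounds the variation of each coordinate. *)
Lemma near_identity_contraction :
  exists2 d : R, 0 < d & forall x y, ball x0 d x -> ball x0 d y ->
    `|(F y - y) - (F x - x)| <= 2^-1 * `|y - x|.
Proof.
(* Each of the [n] partial derivatives contributes at most [eps]; [n.+1]
   keeps [eps] meaningful for [n = 0]. *)
pose eps : R := (2 * n.+1%:R)^-1.
have eps0 : 0 < eps by rewrite invr_gt0 mulr_gt0 ?ltr0n.
have : \forall z \near x0, differentiable F z /\
    forall i : 'I_n, `|delta_mx 0 i - 'D_(delta_mx 0 i) F z| <= eps.
  near=> z; split; first by near: z.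
  near: z; apply: filter_forall => i.
  have /cvgrPdist_le/(_ _ eps0) := @F_C1 (delta_mx 0 i).
  by rewrite F_tangent.
move=> /nbhs_ballP[d /= d0 dF]; exists d => // x y xd yd.
rewrite mulrC; apply: mx_norm_le => [|i j]; first by rewrite mulr_ge0 ?invr_ge0.
rewrite ord1 {i}.
have seg (s : R) : 0 <= s <= 1 -> ball x0 d (x + s *: (y - x)).
  move=> /andP[s0 s1]; move: xd yd; rewrite -ball_normE /= => xd yd.
  have -> : x0 - (x + s *: (y - x)) = (1 - s) *: (x0 - x) + s *: (x0 - y).
    by apply/rowP => k; rewrite !mxE; ring.
  rewrite (le_lt_trans (ler_normD _ _)) // !normrZ !ger0_norm ?subr_ge0 //.
  apply: (@le_lt_trans _ _ (Num.max `|x0 - x| `|x0 - y|)); last first.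
    by rewrite gt_max xd.
  have : `|x0 - x| <= Num.max `|x0 - x| `|x0 - y| by rewrite le_max lexx.
  have : `|x0 - y| <= Num.max `|x0 - x| `|x0 - y| by rewrite le_max lexx orbT.
  by nra.
have [s s01] : exists2 s : R, 0 <= s <= 1 &
    F (x + (y - x)) 0 j - F x 0 j =
    'D_(y - x) (fun z => F z 0 j) (x + s *: (y - x)).
  apply: mean_value_segment => s /seg /dF[Fz _].
  exact: differentiable_entry.
have [Fz Fz_eps] := dF _ (seg _ s01).
have -> : x + (y - x) = y by rewrite addrC subrK.
rewrite derive_entry // => FE.
set z := x + _ in Fz Fz_eps FE.
have -> : (F y - y - (F x - x)) 0 j = \sum_i (y - x) 0 i *
    ('D_(delta_mx 0 i) F z - delta_mx 0 i) 0 j.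
  transitivity (F y 0 j - F x 0 j - (y - x) 0 j); first by rewrite !mxE; ring.
  rewrite FE deriveE // [X in 'd F z X]row_sum_delta linear_sum summxE.
  have -> : (y - x) 0 j = \sum_i (y - x) 0 i * (delta_mx 0 i : 'rV[R]_n) 0 j.
    rewrite {1}[y - x]row_sum_delta summxE.
    by apply: eq_bigr => i _; rewrite mxE.
  rewrite -sumrB; apply: eq_bigr => i _; rewrite linearZ /= -deriveE //.
  rewrite [X in X - _]mxE -mulrBr; congr (_ * _).
  by rewrite [RHS]mxE; congr (_ + _); rewrite [RHS]mxE.
apply: (le_trans (ler_norm_sum _ _ _)).
apply: (@le_trans _ _ (\sum_(i < n) (`|y - x| * eps))).
  apply: ler_sum => i _; rewrite normrM ler_pM // ?mx_entry_le_norm //.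
  by rewrite (le_trans (mx_entry_le_norm _ _ _)) // -normrN opprB.
rewrite sumr_const card_ord -mulrnAr ler_wpM2l // /eps -mulr_natr invfM -mulrA.
by rewrite ler_piMr ?invr_ge0 // ler_pdivrMl ?ltr0n // mulr1 ler_nat.
Unshelve. all: by end_near. Qed.

Hypothesis F_fix : F x0 = x0.
Hypothesis F_involutive : \forall x \near x0, F (F x) = x.

(** With [r x = F x - x], the involution property reads [r (F x) = - r x];
    hence [2 |r x| = |r (F x) - r x| <= |F x - x| / 2 = |r x| / 2]. *)
Lemma involution_germ : \forall x \near x0, F x = x.
Proof.
have [d d0 contr] := near_identity_contraction.
have Fcont : {for x0, continuous F}.
  by apply: differentiable_continuous; exact: nbhs_singleton F_diff.
near=> x.
have xd : ball x0 d x by near: x; exact: nbhsx_ballx.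
have Fxd : ball x0 d (F x).
  by near: x; apply: Fcont; rewrite F_fix; exact: nbhsx_ballx.
have FFx : F (F x) = x by near: x.
have := contr _ _ xd Fxd; rewrite FFx.
have -> : x - F x - (F x - x) = - (2 *: (F x - x)).
  by rewrite scaler_nat mulr2n [RHS]opprD opprB.
rewrite normrN normrZ ger0_norm // => h.
apply/eqP; rewrite -subr_eq0 -normr_eq0 eq_le normr_ge0 andbT.
by move: h; lra.
Unshelve. all: by end_near. Qed.

End TangentToIdentity.

(** * Torus actions in charts *)

Section TorusExp.
Variables (R : realType) (k : nat).
Implicit Types X Y : 'rV[R]_k.

Lemma torus_expD X Y : torus_exp (X + Y) = torus_exp X + torus_exp Y.
Proof. exact: Quotient.pi_add. Qed.

Lemma torus_exp_surj (t : torus R k) : exists X, torus_exp X = t.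
Proof. by exists (repr t); rewrite /torus_exp reprK. Qed.

Lemma torus_exp_eq0 X : (torus_exp X == 0) = (X \in @int_lattice R k).
Proof.
rewrite -[X in X \in _]subr0 Quotient.idealrBE.
by rewrite /torus_exp; congr (_ == _); rewrite piE.
Qed.

Lemma torus_exp0 : torus_exp (0 : 'rV[R]_k) = 0.
Proof. by apply/eqP; rewrite torus_exp_eq0 rpred0. Qed.

End TorusExp.

Lemma fixed_points_closed (T : topologicalType) (f : T -> T) :
  hausdorff_space T -> continuous f -> closed [set p | f p = p].
Proof.
move=> T2 fc p clp; apply: T2 => U W fpU pW.
have fU : nbhs p (f @^-1` U) by exact: fc p _ fpU.
have [q [/= fq [qU qW]]] := clp _ (filterI fU pW).
by exists q; split => //; rewrite -fq.
Qed.

Section Action.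
Variables (R : realType) (n : nat) (M : manifold R n) (k : nat).
Variable A : torus_action M k.

(** Lifting the torus variable to the Lie algebra makes the action a map between
    normed spaces, to which the differential calculus applies. *)
Definition act_rep (i j : atlas M) (tx : 'rV[R]_k * 'rV[R]_n) : 'rV[R]_n :=
  coord (chart_of j) (A (torus_exp tx.1) (point_at (chart_of i) tx.2)).

Definition act_dom (i j : atlas M) : set ('rV[R]_k * 'rV[R]_n) :=
  [set tx | cod (chart_of i) tx.2 /\
            dom (chart_of j) (A (torus_exp tx.1) (point_at (chart_of i) tx.2))].

Lemma act_dom_open i j : open (act_dom i j).
Proof. by have [] := act_smooth A i j. Qed.

Lemma act_rep_smooth i j : smooth_on (act_dom i j) (act_rep i j).
Proof. by have [] := act_smooth A i j. Qed.

Lemma near_act_dom i j tx : act_dom i j tx ->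
  \forall tx' \near tx, act_dom i j tx'.
Proof.
by move=> d; apply: open_nbhs_nbhs; split => //; exact: act_dom_open.
Qed.

Lemma act_rep_diff i j tx : act_dom i j tx -> differentiable (act_rep i j) tx.
Proof. exact: (@act_rep_smooth i j [::] tx). Qed.

Lemma act_rep_cod i j tx : act_dom i j tx -> cod (chart_of j) (act_rep i j tx).
Proof. by case=> _; exact: coord_cod. Qed.

Lemma pair_cst_diff (U V : normedModType R) (a : U) (x : V) :
  differentiable (fun y => (a, y)) x.
Proof. exact: differentiable_pair. Qed.

Lemma pair_cst_diffl (U V : normedModType R) (a : U) (x : V) :
  differentiable (fun y => (y, a)) x.
Proof. exact: differentiable_pair. Qed.

Lemma act_rep_diffr i j t x : act_dom i j (t, x) ->
  differentiable (fun y => act_rep i j (t, y)) x.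
Proof.
move=> d; apply: (@differentiable_comp _ _ _ _ (fun y => (t, y)) (act_rep i j)).
  exact: pair_cst_diff.
exact: act_rep_diff.
Qed.

Lemma act_rep_diffl i j t x : act_dom i j (t, x) ->
  differentiable (fun s => act_rep i j (s, x)) t.
Proof.
move=> d; apply: (@differentiable_comp _ _ _ _ (fun y => (y, x)) (act_rep i j)).
  exact: pair_cst_diffl.
exact: act_rep_diff.
Qed.

Lemma near_act_domr i j t x : act_dom i j (t, x) ->
  \forall y \near x, act_dom i j (t, y).
Proof.
move=> /near_act_dom d.
have c := differentiable_continuous (pair_cst_diff t x).
exact: c d.
Qed.

Lemma near_act_doml i j t x : act_dom i j (t, x) ->
  \forall s \near t, act_dom i j (s, x).
Proof.
move=> /near_act_dom d.
have c := differentiable_continuous (pair_cst_diffl x t).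
exact: c d.
Qed.

(** The derivative in [x] for fixed [t] is a directional derivative of the
    smooth map [act_rep i j], hence is itself differentiable. *)
Lemma act_rep_C1 i j t x v : act_dom i j (t, x) ->
  {for x, continuous (fun y => 'D_v (fun y' => act_rep i j (t, y')) y)}.
Proof.
move=> d.
have -> : (fun y => 'D_v (fun y' => act_rep i j (t, y')) y) =
    (fun tx => 'D_(0, v) (act_rep i j) tx) \o (fun y => (t, y)).
  apply/funext => y; rewrite /derive /=.
  set f := (X in lim (X @ _)); set g := (X in _ = lim (X @ _)).
  suff -> : f = g by [].
  apply/funext => h; rewrite /f /g /=; congr (_ *: (act_rep i j _ - _)).
  by rewrite [RHS]surjective_pairing /= scaler0 add0r.
apply: differentiable_continuous; apply: differentiable_comp.
  exact: pair_cst_diff.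
exact: (@act_rep_smooth i j [:: (0, v)] (t, x)).
Qed.

Lemma act_dom0 i x : cod (chart_of i) x -> act_dom i i (0, x).
Proof.
by move=> ix; split=> //=; rewrite torus_exp0 act0; exact: point_at_dom.
Qed.

Lemma act_rep0 i x : cod (chart_of i) x -> act_rep i i (0, x) = x.
Proof. by move=> ix; rewrite /act_rep /= torus_exp0 act0 point_atK. Qed.

(** The matrix, acting on row vectors, of the map sending an element of the
    Lie algebra to its fundamental vector at [x]. *)
Definition infinitesimal_mx i x : 'M[R]_(k, n) :=
  jacobian (fun Y => act_rep i i (Y, x)) 0.

Lemma fundamentalE i x X : cod (chart_of i) x ->
  fundamental A X i x = X *m infinitesimal_mx i x.
Proof.
move=> ix; rewrite -(deriveEjacobian (f := fun Y => act_rep i i (Y, x))) //.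
exact: act_rep_diffl (act_dom0 ix).
Qed.

Lemma fundamental_mxE i x q (W : 'M[R]_(q, k)) : cod (chart_of i) x ->
  fundamental_mx A W i x = W *m infinitesimal_mx i x.
Proof.
by move=> ix; apply/row_matrixP => a; rewrite rowK fundamentalE // row_mul.
Qed.

Lemma act_exp_continuous p : continuous (fun X => A (torus_exp X) p).
Proof.
move=> X; have [i ip] := atlas_cover p.
have [j jq] := atlas_cover (A (torus_exp X) p).
pose x := coord (chart_of i) p.
have px : p = point_at (chart_of i) x by rewrite coordK.
have d : act_dom i j (X, x) by split => /=; [exact: coord_cod|rewrite -px].
pose f Y := point_at (chart_of j) (act_rep i j (Y, x)).
have c : {for X, continuous f}.
  apply: continuous_comp.
    by apply: differentiable_continuous; exact: act_rep_diffl.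
  by apply: point_at_continuous; exact: act_rep_cod.
have E : {near X, f =1 fun Y => A (torus_exp Y) p}.
  near=> Y; rewrite /f /act_rep /= -px coordK // px.
  have : act_dom i j (Y, x) by near: Y; exact: near_act_doml.
  by case.
rewrite /continuous_at -(nbhs_singleton E).
exact: cvg_trans (near_eq_cvg E) c.
Unshelve. all: by end_near. Qed.

Lemma act_continuous t : continuous (A t).
Proof.
move=> p; have [X <-] := torus_exp_surj t.
have [i ip] := atlas_cover p.
have [j jq] := atlas_cover (A (torus_exp X) p).
have d : act_dom i j (X, coord (chart_of i) p).
  by split => /=; [exact: coord_cod|rewrite coordK].
pose f q := point_at (chart_of j) (act_rep i j (X, coord (chart_of i) q)).
have c : {for p, continuous f}.
  apply: (@continuous_comp _ _ _ (coord (chart_of i))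
    (fun x => point_at (chart_of j) (act_rep i j (X, x)))).
    exact: coord_continuous.
  apply: continuous_comp.
    by apply: differentiable_continuous; exact: act_rep_diffr.
  by apply: point_at_continuous; exact: act_rep_cod.
have E : {near p, f =1 A (torus_exp X)}.
  near=> q; have qi : dom (chart_of i) q.
    by near: q; apply: open_nbhs_nbhs; split => //; exact: dom_open.
  have : act_dom i j (X, coord (chart_of i) q).
    near: q; have := near_act_domr d.
    exact: (coord_continuous ip).
  by case=> _ qj; rewrite /f /act_rep coordK //= coordK.
rewrite /continuous_at -(nbhs_singleton E).
exact: cvg_trans (near_eq_cvg E) c.
Unshelve. all: by end_near. Qed.

End Action.

(** * Rigidity of involutions and one-parameter isotropy *)

Section Isotropy.
Variables (R : realType) (n : nat) (M : manifold R n) (k : nat).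
Variable A : torus_action M k.

Lemma near_dom (i : atlas M) p : dom (chart_of i) p ->
  \forall q \near p, dom (chart_of i) q.
Proof. by move=> ip; apply: open_nbhs_nbhs; split => //; exact: dom_open. Qed.

Lemma near_coord (i : atlas M) p (P : set 'rV[R]_n) : dom (chart_of i) p ->
  (\forall x \near coord (chart_of i) p, P x) ->
  \forall q \near p, P (coord (chart_of i) q).
Proof. by move=> ip nP; exact: (coord_continuous ip) nP. Qed.

Lemma near_point_at (i : atlas M) x (P : set M) : cod (chart_of i) x ->
  (\forall p \near point_at (chart_of i) x, P p) ->
  \forall y \near x, P (point_at (chart_of i) y).
Proof. by move=> ix nP; exact: (point_at_continuous ix) nP. Qed.

(** The interior of the fixed point set is closed: at a limit point [p] of this
    interior, [p] is fixed and, the derivative being continuous, the derivative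
    at [p] is the identity, so that [involution_germ] applies. *)
Lemma involution_rigidity (t : torus R k) (U : set M) :
  connected [set: M] -> t + t = 0 -> open U -> U !=set0 ->
  (forall p, U p -> A t p = p) -> forall p, A t p = p.
Proof.
move=> Mconn tt Uopen [p0 Up0] Ufix.
have [X tE] := torus_exp_surj t.
have tK p : A t (A t p) = p by rewrite -actD tt act0.
pose S := [set p | A t p = p]°.
suff ST : S = [set: M].
  by move=> p; have : [set: M] p by []; rewrite -ST => /nbhs_singleton.
apply: Mconn.
- exists p0; apply: filterS (open_nbhs_nbhs _) => [q|]; first exact: Ufix.
  by split.
- by exists S; [exact: open_interior|rewrite setTI].
exists S; last by rewrite setTI.
move=> p clSp.
have pfix : A t p = p.
  have clF := fixed_points_closed (@points_hausdorff _ _ M)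
    (@act_continuous _ _ _ _ A t).
  by apply: clF; apply: closure_subset clSp; exact: interior_subset.
have [i ip] := atlas_cover p.
set x0 := coord (chart_of i) p.
have d : act_dom A i i (X, x0).
  by split=> /=; [exact: coord_cod|rewrite coordK // tE pfix].
pose F y := act_rep A i i (X, y).
have FE q : dom (chart_of i) q ->
    F (coord (chart_of i) q) = coord (chart_of i) (A t q).
  by move=> iq; rewrite /F /act_rep /= coordK // tE.
have F_diff : \forall x \near x0, differentiable F x.
  by have := near_act_domr d; apply: filterS => x; exact: act_rep_diffr.
(* Otherwise [D_v F] would avoid the value [v] near [x0], but it takes this
   value at points of [S] close to [p]. *)
have F_tangent v : 'D_v F x0 = v.
  apply: contrapT => /eqP Fv.
  have Fv' : \forall x \near x0, 'D_v F x != v.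
    have e0 : 0 < `|'D_v F x0 - v| by rewrite normr_gt0 subr_eq0.
    have /cvgrPdist_lt/(_ _ e0) := act_rep_C1 (v := v) d.
    by apply: filterS => x; apply: contraTneq => ->; rewrite ltxx.
  have [q [Sq [iq]]] := clSp _ (filterI (near_dom ip) (near_coord ip Fv')).
  apply/negP; rewrite negbK; apply/eqP.
  rewrite -[RHS](derive_id (coord (chart_of i) q) v).
  apply: near_eq_derive.
  have := coord_cod iq => cq.
  have : \forall y \near coord (chart_of i) q,
      A t (point_at (chart_of i) y) = point_at (chart_of i) y.
    apply: (near_point_at cq (P := [set p | A t p = p])).
    by rewrite coordK.
  have ycod : \forall y \near coord (chart_of i) q, cod (chart_of i) y.
    by apply: open_nbhs_nbhs; split=> //; exact: cod_open.
  apply: filterS2 ycod => y iy fy.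
  by rewrite /F /act_rep /= tE fy point_atK.
have F_fix : F x0 = x0 by rewrite FE // pfix.
have F_inv : \forall x \near x0, F (F x) = x.
  have := near_act_domr d; apply: filterS => y [/= iy jy].
  rewrite FE.
    by rewrite tE tK point_atK.
  by [].
have F_C1 v := act_rep_C1 (v := v) d.
have := @involution_germ R n F x0 F_diff F_C1 F_tangent F_fix F_inv.
move=> /(near_coord ip).
have := near_coord ip (near_act_domr d).
apply: filterS3 (near_dom ip) => q iq.
  move=> [_ /=]; rewrite coordK // tE => Aq; rewrite FE // => cE.
by rewrite -[LHS](coordK Aq) cE coordK.
Qed.

(** By the group law, the derivative of the curve [Y |-> exp(Y) p] in the
    direction [X] vanishes everywhere near 0 as soon as it vanishes at 0; so
    [exp(h X)] fixes [p] for small [h], and the group law extends this to all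
    multiples. *)
Lemma act_one_parameter_fixed (i : atlas M) x (X : 'rV[R]_k) :
  cod (chart_of i) x -> fundamental A X i x = 0 ->
  forall s : R, A (torus_exp (s *: X)) (point_at (chart_of i) x) =
                point_at (chart_of i) x.
Proof.
move=> ix X0.
set p := point_at (chart_of i) x.
have ip : dom (chart_of i) p by exact: point_at_dom.
pose f Y := act_rep A i i (Y, x).
have d0 : act_dom A i i (0, x) := act_dom0 A ix.
have f0 : f 0 = x := act_rep0 A ix.
have fX Y : act_dom A i i (Y, x) -> 'D_X f Y = 0.
  move=> dY.
  have -> : 'D_X f Y = 'D_X (fun T => f (T + Y)) 0.
    rewrite /derive; set u := (X in lim (X @ _)).
    set v := (X in _ = lim (X @ _)).
    suff -> : u = v by [].
    by apply/funext => h; rewrite /u /v /= addr0 add0r.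
  (* [f (T + Y)] is the action of [exp Y] applied to [f T]. *)
  have -> : 'D_X (fun T => f (T + Y)) 0 =
            'D_X ((fun y => act_rep A i i (Y, y)) \o f) 0.
    apply: near_eq_derive; have := near_act_doml d0.
    apply: filterS => T [/= _ dT]; rewrite /f /act_rep /= coordK //.
    by rewrite addrC torus_expD actD.
  have df0 := act_rep_diffl d0.
  have dG : differentiable (fun y => act_rep A i i (Y, y)) (f 0).
    by rewrite f0; exact: act_rep_diffr.
  rewrite deriveE; last exact: differentiable_comp.
  by rewrite diff_comp //= -(deriveE (f := f)) // [X in 'd _ _ X]X0 linear0.
have /nbhs_ballP[e /= e0 de] := near_act_doml d0.
have small (h : R) : `|h *: X| < e -> A (torus_exp (h *: X)) p = p.
  move=> he.
  have seg (s : R) : 0 <= s <= 1 -> act_dom A i i (s *: (h *: X), x).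
    move=> /andP[s_ge0 s1]; apply: de; rewrite -ball_normE /= sub0r normrN.
    rewrite normrZ ger0_norm //.
    by rewrite (le_lt_trans _ he) // ler_piMl.
  have [_ /= dh] : act_dom A i i (h *: X, x).
    by rewrite -[h *: X]scale1r; apply: seg; rewrite ler01 lexx.
  suff : f (h *: X) = f 0.
    by rewrite f0 /f /act_rep /= -/p => fh; rewrite -[LHS](coordK dh) fh.
  apply/rowP => j.
  have [s s01] : exists2 s : R, 0 <= s <= 1 & f (0 + h *: X) 0 j - f 0 0 j =
      'D_(h *: X) (fun Y => f Y 0 j) (0 + s *: (h *: X)).
    apply: (@mean_value_segment _ _ (fun Y => f Y 0 j)) => s s01; rewrite add0r.
    by apply: differentiable_entry; apply: act_rep_diffl; exact: seg.
  rewrite !add0r derive_entry; last by apply: act_rep_diffl; exact: seg.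
  rewrite deriveE; last by apply: act_rep_diffl; exact: seg.
  rewrite linearZ /= -deriveE; last by apply: act_rep_diffl; exact: seg.
  rewrite fX; last exact: seg.
  by rewrite scaler0 mxE => /eqP; rewrite subr_eq0 => /eqP.
move=> s.
pose N := (Num.bound (`|s *: X| / e)).
have N0 : 0 < N.+1%:R :> R by rewrite ltr0n.
have hN : `|(s / N.+1%:R) *: X| < e.
  rewrite mulrC -scalerA normrZ ger0_norm ?invr_ge0 ?ler0n //.
  rewrite ltr_pdivrMl // -ltr_pdivrMr //.
  have bN : `|s *: X| / e < N%:R.
    by apply: archi_boundP; rewrite divr_ge0 // ltW.
  by rewrite (lt_trans bN) // ltr_nat.
have mult m : A (torus_exp (m%:R *: ((s / N.+1%:R) *: X))) p = p.
  elim: m => [|m IHm]; first by rewrite scale0r torus_exp0 act0.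
  by rewrite -natr1 scalerDl scale1r torus_expD actD small.
by have := mult N.+1; rewrite scalerA mulrC divfK // gt_eqF.
Qed.

End Isotropy.

(** * Effective actions are locally free somewhere *)

(** The finite case of the Baire category theorem, valid in any space. *)
Lemma finite_closed_cover (T : topologicalType) (I : eqType) (s : seq I)
    (F : I -> set T) (O : set T) :
  (forall i, closed (F i)) -> open O -> O !=set0 ->
  (forall p, O p -> exists2 i, i \in s & F i p) ->
  exists i (U : set T), [/\ i \in s, open U, U !=set0 & U `<=` F i].
Proof.
move=> Fcl; elim: s O => [|i s IHs] O Oo [p Op] cover.
  by have [] := cover p Op.
have [OF|] := pselect (O `<=` F i).
  by exists i, O; split=> //; [rewrite mem_head|exists p].
move=> /existsNP[q /not_implyP[Oq Fq]].
have [|||j [U [js Uo U0 UF]]] := IHs (O `&` ~` F i).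
- by apply: openI => //; rewrite openC.
- by exists q.
- move=> r [Or Fr]; have [j] := cover r Or.
  by rewrite inE => /orP[/eqP->//|js] Fj; exists j.
by exists j, U; split=> //; rewrite inE js orbT.
Qed.

Section HalfPeriods.
Variables (R : realType) (k : nat).

Lemma half_indicator_double (S : {set 'I_k}) :
  torus_exp (half_indicator R S) + torus_exp (half_indicator R S) = 0.
Proof.
rewrite -torus_expD; apply/eqP; rewrite torus_exp_eq0.
apply/forallP => i; rewrite !mxE; case: ifP => _; last by rewrite addr0 rpred0.
by rewrite -[2^-1]div1r -splitr rpred1.
Qed.

Lemma half_indicator_neq0 (S : {set 'I_k}) :
  S != finset.set0 -> torus_exp (half_indicator R S) != 0.
Proof.
case/finset.set0Pn => i iS; rewrite torus_exp_eq0.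
apply/negP => /forallP/(_ i); rewrite mxE iS => /intrP[m mE].
have : (m * 2)%:~R = 1 :> R by rewrite intrM -mE mulVf.
move/eqP; rewrite -[1]/(1%:~R) eqr_int; lia.
Qed.

Lemma torus_exp_int (m : 'I_k -> int) :
  torus_exp (\row_i (m i)%:~R : 'rV[R]_k) = 0.
Proof.
by apply/eqP; rewrite torus_exp_eq0; apply/forallP => i; rewrite mxE intr_int.
Qed.

End HalfPeriods.

Section EffectiveActions.
Variables (R : realType) (n : nat) (M : manifold R n) (k : nat).
Variable A : torus_action M k.

(** The isotropy group of [p] is closed, and contains with [exp (s X)] elements
    arbitrarily close to one of the finitely many half indicators. *)
Lemma half_period_fixed (p : M) (X : 'rV[R]_k) : X != 0 ->
  (forall s : R, A (torus_exp (s *: X)) p = p) ->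
  exists2 S : {set 'I_k}, S != finset.set0 &
    A (torus_exp (half_indicator R S)) p = p.
Proof.
move=> X0 Xfix; apply: contrapT => nofix.
have avoid : \forall e \near (0 : R)^'+,
    forall S : {set 'I_k}, S != finset.set0 -> forall Y,
    ball (half_indicator R S) e Y -> A (torus_exp Y) p <> p.
  apply: filter_forall => S.
  have [->|S0] := eqVneq S finset.set0; first by near=> e.
  have closedp : closed [set p].
    exact/accessible_closed_set1/hausdorff_accessible/points_hausdorff.
  have Sp : (~` [set p]) (A (torus_exp (half_indicator R S)) p).
    by move=> fixS; apply: nofix; exists S.
  have := open_nbhs_nbhs (conj (closed_openC closedp) Sp).
  move=> /(@act_exp_continuous _ _ _ _ A p (half_indicator R S)).
  move=> /nbhs_ballP[d /= d0 dS].
  near=> e => _ Y Ye; apply: dS.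
  by apply: le_ball Ye; near: e; exact: nbhs_right_le.
have [e [e0 He]] : exists e : R, 0 < e /\
    forall S : {set 'I_k}, S != finset.set0 -> forall Y,
    ball (half_indicator R S) e Y -> A (torus_exp Y) p <> p.
  near (0 : R)^'+ => e; exists e; split; first by near: e; exact: nbhs_right_gt.
  by near: e.
have e20 : 0 < e / 2 by rewrite divr_gt0.
have [s [S [q [S0 sE]]]] := half_indicator_approximation X0 e20.
pose m : 'rV[R]_k := \row_i (q i)%:~R.
apply: (He S S0 (s *: X - m)).
  rewrite -ball_normE /= distrC.
  apply: (@le_lt_trans _ _ (e / 2)); last first.
    by rewrite ltr_pdivrMr // ltr_pMr // ltr1n.
  apply: mx_norm_le => [|i j]; first exact: ltW.
  by rewrite ord1 !mxE addrAC ltW //; have := sE j; rewrite mxE.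
have mfix : A (torus_exp (- m)) p = p.
  have -> : - m = \row_i (- q i)%:~R by apply/rowP => i; rewrite !mxE intrN.
  by rewrite torus_exp_int act0.
by rewrite torus_expD actD mfix Xfix.
Unshelve. all: by end_near. Qed.

(** Otherwise the fixed point sets of the elements of order two cover the
    manifold; one of them has interior points, and that element acts
    trivially. *)
Lemma effective_locally_free_point :
  connected [set: M] -> effective A -> (0 < k)%N ->
  exists (i : atlas M) (x : 'rV[R]_n), cod (chart_of i) x /\
    forall X, fundamental A X i x = 0 -> X = 0.
Proof.
move=> Mconn Aeff k0; apply: contrapT => nofree.
pose halves := [seq S <- enum {set 'I_k} | S != finset.set0].
(* On an empty manifold every element would act trivially. *)
have Mne : [set: M] !=set0.
  apply: contrapT => M0.
  have T0 : [set: 'I_k]%SET != finset.set0.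
    by apply/finset.set0Pn; exists (Ordinal k0); rewrite finset.in_setT.
  have /eqP[] := half_indicator_neq0 R T0.
  by apply: Aeff => p; case: M0; exists p.
have Fcl (S : {set 'I_k}) :
    closed [set p | A (torus_exp (half_indicator R S)) p = p].
  exact: fixed_points_closed (@points_hausdorff _ _ M)
    (@act_continuous _ _ _ _ A _).
have cover p : [set: M] p -> exists2 S, S \in halves &
    [set p | A (torus_exp (half_indicator R S)) p = p] p.
  move=> _; have [i ip] := atlas_cover p.
  have cp := coord_cod ip.
  have [X [X0 /eqP Xn0]] :
      exists X, fundamental A X i (coord (chart_of i) p) = 0 /\ X <> 0.
    apply: contrapT => noX; apply: nofree.
    exists i, (coord (chart_of i) p); split=> // X X0.
    by apply: contrapT => Xn0; apply: noX; exists X.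
  have := act_one_parameter_fixed cp X0; rewrite coordK // => Xfix.
  have [S S0 Sfix] := half_period_fixed Xn0 Xfix.
  by exists S => //; rewrite mem_filter S0 mem_enum.
have [S [U [SH Uo U0 UF]]] := finite_closed_cover Fcl openT Mne cover.
have := SH; rewrite mem_filter => /andP[S0 _].
have /eqP[] := half_indicator_neq0 R S0.
apply: Aeff; apply: involution_rigidity Mconn _ Uo U0 UF.
exact: half_indicator_double.
Qed.

(** * Isotropy of orbits *)

(** Differentiate the identity [nu (exp(Y) p) = nu p] at [Y = 0]. *)
Lemma multi_moment_isotropic r (alpha : diff_form M (r + 1))
    (nu : M -> 'M[R]_(r, k) -> R) :
  multi_moment_map A alpha nu ->
  forall i x, cod (chart_of i) x -> forall W : 'M[R]_(r + 1, k),
    alpha i x (fundamental_mx A W i x) = 0.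
Proof.
move=> [_ nu_smooth nu_inv nu_d] i x ix W.
set X := dsubmx W : 'rV_k; set W1 := usubmx W.
have -> : fundamental_mx A W i x =
    col_mx (fundamental_mx A W1 i x) (fundamental A X i x).
  by rewrite !fundamental_mxE // fundamentalE // -mul_col_mx vsubmxK.
have := nu_d i x ix W1 (fundamental A X i x); rewrite /contract => <-.
have d0 : act_dom A i i (0, x) := act_dom0 A ix.
pose f Y := act_rep A i i (Y, x).
have f0 : f 0 = x := act_rep0 A ix.
pose h y : R := nu (point_at (chart_of i) y) W1.
have dh : differentiable h (f 0) by rewrite f0; exact: (nu_smooth i W1 [::] x).
have df : differentiable f 0 by exact: act_rep_diffl.
have : 'D_X (h \o f) 0 = 0.
  rewrite -[RHS](derive_cst (h x) 0 X); apply: near_eq_derive.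
  have := near_act_doml d0; apply: filterS => Y [/= _ dY].
  by rewrite /h /f /act_rep /= coordK.
rewrite deriveE; last exact: differentiable_comp.
by rewrite diff_comp //= -(deriveE (f := f)) // -deriveE // f0.
Qed.

End EffectiveActions.

Theorem proposition2p3 (R : realType) (M : manifold R 7)
  (phi : diff_form M 3) (psi : diff_form M 4)
  (hG2 : g2_manifold phi psi)
  (k : nat) (A : torus_action M k)
  (hphi : preserves A phi)
  (heff : effective A)
  (hmulti : multi_hamiltonian A phi psi) :
  (2 <= k <= 4)%N.
Proof.
apply/andP; split.
  by case: hmulti => -[k_ge _] //; exact: ltnW k_ge.
rewrite leqNgt; apply/negP => k5.
have k0 : (0 < k)%N by exact: leq_trans k5.
have [i [x [ix free]]] :=
  effective_locally_free_point (g2_connected hG2) heff k0.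
pose J := infinitesimal_mx A i x.
have Jfree : row_free J.
  by apply: inj_row_free => X XJ; apply: free; rewrite fundamentalE.
(* The fundamental vectors at [x] of the first five basis vectors. *)
pose V : 'M[R]_(5, 7) := pid_mx 5 *m J.
have Vfree : row_free V.
  by rewrite /row_free mxrankMfree // rank_pid_mx.
have alt := form_alternating phi ix.
have g2 := g2_pointwise hG2 ix.
case: hmulti => -[_ [nu nuP]].
  apply: (g2_form_dim5 alt g2 Vfree) => B.
  rewrite mulmxA -fundamental_mxE //.
  exact: (multi_moment_isotropic nuP ix (B *m pid_mx 5)).
apply: (g2_dual_dim5 alt g2 (g2_hodge hG2 ix) Vfree) => B.
rewrite mulmxA -fundamental_mxE //.
exact: (multi_moment_isotropic nuP ix (B *m pid_mx 5)).
Qed.
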